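(* Let $G$ be a split comparability graph. Then the dimension of an induced poset of $G$ is at most three. Moreover, the bound is tight: there is a split comparability graph having an induced poset of dimension exactly three.
   Context: All graphs are finite and simple. A split graph is a graph whose vertex set can be partitioned into a clique and an independent set. A comparability graph is a graph admitting a transitive orientation; a split comparability graph is a split graph that is a comparability graph. An induced poset of a comparability graph $G$ is a partially ordered set on the vertex set of $G$ obtained from a transitive orientation of $G$, i.e. a partial order whose comparability graph is $G$ (two distinct vertices are comparable if and only if they are adjacent in $G$). The dimension of a poset is the least number of linear extensions (total orders) whose intersection is the given partial order. *)

(* Defs.v *)
From mathcomp Require Import all_boot.

Set Implicit Arguments.
Unset Strict Implicit.
Unset Printing Implicit Defensive.

(* Finite simple graphs on T are symmetric irreflexive relations e : rel T,   *)
(* and partially ordered sets on T are reflexive orders le : rel T.           *)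

Definition simple_graph (T : finType) (e : rel T) : Prop :=
  symmetric e /\ irreflexive e.

Definition clique (T : finType) (e : rel T) (K : {set T}) : Prop :=
  {in K &, forall x y, x != y -> e x y}.

Definition independent (T : finType) (e : rel T) (I : {set T}) : Prop :=
  {in I &, forall x y, ~~ e x y}.

(* Either part may be empty, which is why finset's partition is not used.     *)
Definition split_graph (T : finType) (e : rel T) : Prop :=
  exists K I : {set T},
    [/\ K :|: I = [set: T], [disjoint K & I], clique e K & independent e I].

(* o x y means that the edge {x, y} is directed from x to y; each edge gets   *)
(* exactly one direction.                                                     *)
Definition orientation (T : finType) (e o : rel T) : Prop :=
  subrel o e /\ (forall x y, e x y -> o x y (+) o y x).

Definition transitive_orientation (T : finType) (e o : rel T) : Prop :=
  orientation e o /\ transitive o.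

Definition comparability_graph (T : finType) (e : rel T) : Prop :=
  exists o : rel T, transitive_orientation e o.

Definition split_comparability_graph (T : finType) (e : rel T) : Prop :=
  split_graph e /\ comparability_graph e.

Definition partial_order (T : finType) (le : rel T) : Prop :=
  [/\ reflexive le, antisymmetric le & transitive le].

Definition linear_order (T : finType) (le : rel T) : Prop :=
  partial_order le /\ total le.

Definition induced_poset (T : finType) (e le : rel T) : Prop :=
  partial_order le /\
  (forall x y, x != y -> (le x y || le y x) = e x y).

Definition linear_extension (T : finType) (le lin : rel T) : Prop :=
  linear_order lin /\ subrel le lin.

(* A realizer is nonempty, so chains (one-point posets included) have         *)
(* dimension 1. Repetitions in the family L do not affect the least size.     *)
Definition realizable (T : finType) (le : rel T) (d : nat) : Prop :=
  0 < d /\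
  exists L : 'I_d -> rel T,
    (forall i, linear_extension le (L i)) /\
    (forall x y, le x y = [forall i, L i x y]).

Definition has_dimension (T : finType) (le : rel T) (d : nat) : Prop :=
  realizable le d /\ (forall k, realizable le k -> d <= k).

(* The induced posets of a graph are exactly the reflexive closures of its    *)
(* transitive orientations.                                                   *)
Lemma induced_posetP (T : finType) (e le : rel T) : simple_graph e ->
  induced_poset e le <->
  exists2 o : rel T, transitive_orientation e o &
    forall x y, le x y = (x == y) || o x y.
Proof.
move=> [eS eI]; split=> [[[leR leA leT] eE]|[o [[oe oX] oT] leE]].
  exists (fun x y => (x != y) && le x y) => [|x y]; last first.
    by have [->|] := eqVneq x y; rewrite ?leR.
  split; first split=> x y.
  - by case/andP=> nxy lxy; rewrite -eE ?lxy.
  - have [->|nxy] := eqVneq x y; first by rewrite eI.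
    rewrite -eE //= => xy.
    have := leA x y; case: (le x y) (le y x) xy => [] [] //= _ /(_ isT) exy.
    by rewrite exy eqxx in nxy.
  move=> y x z /andP[nxy lxy] /andP[nyz lyz]; rewrite (leT y) // andbT.
  apply: contraNneq nxy => exz; rewrite -exz in lyz.
  by apply/eqP/leA; rewrite lxy lyz.
split=> [|x y nxy].
  split=> [x|x y|y x z]; rewrite ?leE ?eqxx //.
    case: (eqVneq x y) => //= nxy /andP[oxy].
    by have := oX _ _ (oe _ _ oxy); rewrite oxy => /negPf->.
  case: (eqVneq x y) => [->|_] //= oxy.
  by case: (eqVneq y z) => [<-|_] /= => [_|/(oT _ _ _ oxy)->];
     rewrite ?oxy orbT.
rewrite !leE (eq_sym y) (negPf nxy) /=.
apply/orP/idP => [[/oe|oyx]|/oX].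
- by [].
- by rewrite eS; apply: oe.
- by case: (o x y) => //= ?; [left | right].
Qed.

(* Main.v *)
Require Import Defs.
From mathcomp Require Import all_boot.
From mathcomp Require Import zify.
From Stdlib Require Import Classical_Prop.

(** In an induced poset of a split graph, the clique is a chain [K] and its
    complement is an antichain [I].  The elements of [K] below a given [x] in
    [I] form an initial segment of the chain and those above it a final
    segment, so [x] can be inserted into the chain anywhere between the two.

    Upper bound.  Three linear extensions suffice.  The first inserts every
    element of [I] as low as possible and the second as high as possible;
    together they reverse every incomparable pair that meets [K] ([height_lt],
    applied to the poset and to its dual).  Since [I] is an antichain, no
    element of the chain lies above one element of [I] and below another; hence
    all of [I] also fits into one single gap of the chain, where it may be
    ordered at will.  The third extension does this, ordering [I] by the
    converse of the first extension, so that the pairs inside [I] are reversed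
    as well ([chain_antichain_realizable3]).

    Lower bound.  Take a chain with four elements and three further elements
    inserted crosswise ([seven_le]).  Seven of its incomparable pairs can be
    oriented and listed cyclically so that no linear order extending the poset
    follows two consecutive ones; as seven is odd, two linear extensions are
    not enough ([seven_dim_ge3]). *)

Set Implicit Arguments.
Unset Strict Implicit.
Unset Printing Implicit Defensive.

(** * Linear extensions obtained from strictly monotone functions *)

Definition converse (T : Type) (r : rel T) : rel T := fun x y => r y x.

Definition lex (T : Type) (f : T -> nat) (r : rel T) : rel T :=
  fun x y => (f x < f y) || (f x == f y) && r x y.

Lemma converse_partial_order (T : finType) (r : rel T) :
  partial_order r -> partial_order (converse r).
Proof.
case=> rR rA rT; split=> [x|x y|y x z]; rewrite /converse ?rR //.
  by rewrite andbC; apply: rA.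
by move=> xy yz; apply: rT yz xy.
Qed.

Lemma converse_linear_order (T : finType) (r : rel T) :
  linear_order r -> linear_order (converse r).
Proof.
by case=> /converse_partial_order rP rT; split=> // x y; apply: rT.
Qed.

Lemma lex_linear_order (T : finType) (f : T -> nat) (r : rel T) :
  linear_order r -> linear_order (lex f r).
Proof.
rewrite /lex => -[[rR rA rT] rtot]; split; first split.
- by move=> x; rewrite eqxx rR orbT.
- move=> x y; case: (ltngtP (f x) (f y)) => //= _; exact: rA.
- move=> y x z /orP[xy|/andP[/eqP-> xy]] /orP[yz|/andP[/eqP<- yz]].
  + by rewrite (ltn_trans xy yz).
  + by rewrite xy.
  + by rewrite yz.
  + by rewrite eqxx (rT _ _ _ xy yz) orbT.
- move=> x y; case: (ltngtP (f x) (f y)) => //= _; exact: rtot.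
Qed.

Lemma lex_linear_extension (T : finType) (le : rel T) (f : T -> nat)
    (r : rel T) :
  linear_order r -> (forall x y, le x y -> x != y -> f x < f y) ->
  linear_extension le (lex f r).
Proof.
move=> rL fM; have lexL := lex_linear_order f rL; split=> // x y lexy.
have [<-|nxy] := eqVneq x y; first by case: lexL => -[->].
by rewrite /lex fM.
Qed.

Lemma exists_linear_order (T : finType) : exists r : rel T, linear_order r.
Proof.
exists (fun x y => enum_rank x <= enum_rank y); split; first split.
- by move=> x.
- by move=> x y; rewrite -eqn_leq => /eqP/val_inj/enum_rank_inj.
- by move=> y x z; apply: leq_trans.
- by move=> x y; apply: leq_total.
Qed.

Lemma partial_order_gtF (T : finType) (r : rel T) (x y : T) :
  partial_order r -> r x y -> x != y -> ~~ r y x.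
Proof.
move=> [_ rA _] xy nxy; apply: contraNN nxy => yx.
by apply/eqP/rA; rewrite xy yx.
Qed.

(** * Posets made of a chain and an antichain *)

Definition chain_antichain (T : finType) (le : rel T) (K : {set T}) : Prop :=
  [/\ partial_order le,
      {in K &, total le} &
      {in ~: K &, forall x y, le x y -> x = y}].

Lemma chain_antichain_converse (T : finType) (le : rel T) (K : {set T}) :
  chain_antichain le K -> chain_antichain (converse le) K.
Proof.
move=> [leP tot anti]; split; first exact: converse_partial_order.
  by move=> x y xK yK; apply: tot.
by move=> x y xI yI /(anti _ _ yI xI).
Qed.

Lemma split_chain_antichain (T : finType) (e le : rel T) :
  split_graph e -> induced_poset e le -> exists K, chain_antichain le K.
Proof.
move=> [K [I [KI _ Kc Ic]]] [leP leE]; exists K; split=> //.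
  move=> x y xK yK; have [<-|nxy] := eqVneq x y; first by case: leP => ->.
  by rewrite leE // Kc.
have inI z : z \in ~: K -> z \in I.
  by move: (in_setT z); rewrite -KI !inE => /orP[->|].
move=> x y /inI xI /inI yI xy; apply/eqP; apply: contraNT (Ic _ _ xI yI) => nxy.
by rewrite -leE // xy.
Qed.

Definition chain_below (T : finType) (le : rel T) (K : {set T}) (x : T) : nat :=
  #|[set k in K | le k x]|.

(** The place of [x] when each element of the antichain is inserted into the
    chain as low as possible: just after the last element of [K] below it. *)
Definition height (T : finType) (le : rel T) (K : {set T}) (x : T) : nat :=
  (chain_below le K x).*2 + (x \notin K).

Lemma chain_below_le (T : finType) (le : rel T) (K : {set T}) (x y : T) :
  chain_antichain le K -> le x y -> chain_below le K x <= chain_below le K y.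
Proof.
move=> [[_ _ leT] _ _] xy; apply/subset_leq_card/subsetP=> k.
by rewrite !inE => /andP[-> kx]; apply: leT xy.
Qed.

(** A chain element below [y] is comparable with [x], and it is not above [x]
    since [x] is not below [y]; so it lies below [x]. *)
Lemma chain_below_lt (T : finType) (le : rel T) (K : {set T}) (x y : T) :
  chain_antichain le K -> x \in K -> ~~ le x y ->
  chain_below le K y < chain_below le K x.
Proof.
move=> [[leR _ leT] tot _] xK nxy; apply/proper_card/properP; split.
  apply/subsetP=> k; rewrite !inE => /andP[kK ky]; rewrite kK /=.
  by case/orP: (tot _ _ kK xK) => // /leT/(_ ky) xy; rewrite xy in nxy.
by exists x; rewrite !inE xK ?leR.
Qed.

Lemma height_lt (T : finType) (le : rel T) (K : {set T}) (x y : T) :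
  chain_antichain le K -> x \in K -> ~~ le x y ->
  height le K y < height le K x.
Proof.
move=> leK xK nxy; have := chain_below_lt leK xK nxy.
by rewrite /height xK; case: (y \in K) => /=; lia.
Qed.

Lemma height_mono (T : finType) (le : rel T) (K : {set T}) (x y : T) :
  chain_antichain le K -> le x y -> x != y -> height le K x < height le K y.
Proof.
move=> leK xy nxy; have [yK|yI] := boolP (y \in K).
  apply: height_lt => //.
  by apply: partial_order_gtF xy nxy; case: leK.
have xK : x \in K.
  apply: contraNT nxy => xI; case: leK => _ _ anti.
  by apply/eqP/anti; rewrite ?inE.
by have := chain_below_le leK xy; rewrite /height xK yI /=; lia.
Qed.

(** All of the antichain sits on one level, just after the last element of the
    chain that lies below some element of the antichain. *)
Definition level (T : finType) (le : rel T) (K : {set T}) (x : T) : nat :=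
  if x \notin K then #|T|.+1
  else if [exists y in ~: K, le x y] then chain_below le K x
  else #|T|.+1 + chain_below le K x.

Lemma level_mono (T : finType) (le : rel T) (K : {set T}) (x y : T) :
  chain_antichain le K -> le x y -> x != y -> level le K x < level le K y.
Proof.
move=> leK xy nxy; have [leP _ anti] := leK; have [_ _ leT] := leP.
have nyx := partial_order_gtF leP xy nxy.
have xyB := chain_below_lt leK ^~ nyx.
have xT : chain_below le K x <= #|T| by apply: max_card.
rewrite /level; have [xK|xI] := boolP (x \in K); last first.
  have yK : y \in K.
    by apply: contraNT nxy => yI; apply/eqP/anti; rewrite ?inE.
  rewrite yK /=; case: existsP => [[z /andP[zI yz]]|_]; last first.
    by have := xyB yK; lia.
  (* [x < y < z] would be a comparability inside the antichain *)
  have xz : x = z by apply: (anti _ _ _ zI (leT _ _ _ xy yz)); rewrite inE.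
  by rewrite xz yz in nyx.
have [yK|yI] := boolP (y \in K); rewrite /=; last first.
  case: existsP => [_|[]]; first by rewrite ltnS.
  by exists y; rewrite inE yI.
case: (existsP (P := fun z => (z \in ~: K) && le y z)) => [[z /andP[zI yz]]|_].
  case: existsP => [_|[]]; first exact: xyB.
  by exists z; rewrite zI (leT _ _ _ xy yz).
by have := xyB yK; case: ifP; lia.
Qed.

(** A pair that meets the chain is handled by [low] if its chain element comes
    first and by [high] if it comes second. *)
Lemma chain_antichain_realizable3 (T : finType) (le : rel T) (K : {set T}) :
  chain_antichain le K -> realizable le 3.
Proof.
move=> leK; have leK' := chain_antichain_converse leK.
have [r rL] := exists_linear_order T.
pose low := lex (height le K) r.
pose high := converse (lex (height (converse le) K) r).
pose mid := lex (level le K) (converse low).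
have lowL : linear_extension le low.
  by apply: lex_linear_extension => // x y; apply: height_mono.
have highL : linear_extension le high.
  have [dualL dualE] : linear_extension (converse le)
      (lex (height (converse le) K) r).
    by apply: lex_linear_extension => // x y; apply: height_mono.
  by split=> [|x y]; [apply: converse_linear_order | apply: dualE].
have midL : linear_extension le mid.
  apply: lex_linear_extension; last by move=> x y; apply: level_mono.
  by apply: converse_linear_order; case: lowL.
split=> //.
exists (fun i : 'I_3 => match val i with 0 => low | 1 => high | _ => mid end).
split=> [[[|[|i]] ?] //|x y]; apply/idP/forallP => [xy|all_xy].
  by case=> [[|[|i]] ?] /=; [case: lowL|case: highL|case: midL] => _; apply.
have lxy : low x y := all_xy (Ordinal (isT : 0 < 3)).
have hxy : high x y := all_xy (Ordinal (isT : 1 < 3)).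
have mxy : mid x y := all_xy (Ordinal (isT : 2 < 3)).
apply/negPn/negP => nxy.
have neq : x != y by apply: contraNneq nxy => ->; case: leK => -[->].
have lex_false f g : g y < g x -> lex g f x y -> False.
  by move=> fyx; rewrite /lex; case: ltngtP fyx.
have [xK|xI] := boolP (x \in K).
  exact: lex_false (height_lt leK xK nxy) lxy.
have [yK|yI] := boolP (y \in K).
  have := height_lt leK' yK (nxy : ~~ converse le y x).
  by move: hxy; rewrite /high /converse /lex; case: ltngtP.
(* inside the antichain, [mid] is the converse of [low] *)
have lyx : low y x by move: mxy; rewrite /mid /lex /level xI yI ltnn eqxx.
have [[lowP _] _] := lowL.
by have := partial_order_gtF lowP lxy neq; rewrite lyx.
Qed.

Lemma split_realizable3 (T : finType) (e le : rel T) :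
  split_graph e -> induced_poset e le -> realizable le 3.
Proof.
by move=> eS /(split_chain_antichain eS)[K]; apply: chain_antichain_realizable3.
Qed.

Lemma realizable_has_dimension (T : finType) (le : rel T) (n : nat) :
  realizable le n -> exists2 d, has_dimension le d & d <= n.
Proof.
elim/ltn_ind: n => n IHn len.
have [[m [mn lem]]|min_n] := classic (exists m, m < n /\ realizable le m).
  have [d dP dm] := IHn m mn lem.
  by exists d => //; apply: leq_trans dm (ltnW mn).
exists n => //; split=> // k lek; rewrite leqNgt; apply/negP => kn.
by apply: min_n; exists k.
Qed.

(** * A poset of dimension three *)

(** The chain is [inl 0 < inl 1 < inl 2 < inl 3]; the antichain element [inr i]
    is above the first [i] elements of the chain and below the last [2 - i]. *)
Definition seven_le : rel ('I_4 + 'I_3) := fun u v =>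
  match u, v with
  | inl k, inl l => k <= l
  | inl k, inr i => k < i
  | inr i, inl k => i.+1 < k
  | inr i, inr j => i == j
  end.

Definition seven_graph : rel ('I_4 + 'I_3) :=
  fun u v => (u != v) && (seven_le u v || seven_le v u).

Lemma seven_partial_order : partial_order seven_le.
Proof.
split.
- by case=> i /=.
- case=> [k|i] [l|j]; rewrite /seven_le.
  + by rewrite -eqn_leq => /eqP/val_inj->.
  + by move=> /andP[? ?]; lia.
  + by move=> /andP[? ?]; lia.
  + by case/andP=> /eqP->.
- case=> [k|i] [l|j] [m|n]; rewrite /seven_le; try lia.
  + by have := ltn_ord n; lia.
  + by move=> li /eqP<-.
  + by move=> /eqP->.
  + by move=> /eqP->.
Qed.

Lemma seven_induced : induced_poset seven_graph seven_le.
Proof.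
by split=> [|u v nuv]; [apply: seven_partial_order | rewrite /seven_graph nuv].
Qed.

Lemma seven_simple : simple_graph seven_graph.
Proof.
by split=> [u v|u]; rewrite /seven_graph ?eqxx // eq_sym orbC.
Qed.

Lemma seven_split : split_graph seven_graph.
Proof.
exists [set u | is_inl u], [set u | ~~ is_inl u]; split.
- by apply/setP=> u; rewrite !inE orbN.
- by rewrite -setI_eq0; apply/eqP/setP=> u; rewrite !inE andbN.
- case=> [k|i] [l|j]; rewrite ?inE //= => _ _ nkl.
  by rewrite /seven_graph nkl leq_total.
- case=> [k|i] [l|j]; rewrite ?inE //= => _ _.
  rewrite /seven_graph /=; apply/negP => /andP[nij].
  by case/orP=> /eqP ij; rewrite ij eqxx in nij.
Qed.

Lemma seven_split_comparability : split_comparability_graph seven_graph.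
Proof.
split; first exact: seven_split.
have /(induced_posetP _ seven_simple)[o oP _] := seven_induced.
by exists o.
Qed.

(** Both reversals in one linear order would close the cycle
    [v < u <= v' < u' <= v]. *)
Lemma reversals_incompatible (T : finType) (le lin : rel T) (u v u' v' : T) :
  linear_extension le lin -> le u v' -> le u' v ->
  ~~ lin u v -> ~~ lin u' v' -> False.
Proof.
move=> [[[_ _ linT] tot] sub] uv' u'v nuv nu'v'.
have vu : lin v u by have := tot u v; rewrite (negPf nuv).
case/negP: nu'v'; apply: (linT u) (sub _ _ uv').
by apply: (linT v) vu; apply: sub.
Qed.

(** Each extension index is sent to a boolean, injectively when there are at
    most two indices; incompatible reversals need different booleans, and the
    seven reversals below are cyclically incompatible. *)
Lemma seven_dim_ge3 (k : nat) : realizable seven_le k -> 3 <= k.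
Proof.
move=> [_ [L [Lext LE]]]; rewrite leqNgt; apply/negP => k2.
pose c n (n4 : n < 4) : 'I_4 + 'I_3 := inl (Ordinal n4).
pose a n (n3 : n < 3) : 'I_4 + 'I_3 := inr (Ordinal n3).
have rev u v : ~~ seven_le u v -> exists i, ~~ L i u v.
  by rewrite LE negb_forall => /existsP.
have incompatible u v u' v' i j : ~~ L i u v -> ~~ L j u' v' ->
    seven_le u v' -> seven_le u' v -> (val i == 0) != (val j == 0).
  move=> nuv nu'v' uv' u'v; apply/eqP => ij.
  have eij : i = j.
    apply: val_inj; move: ij (ltn_ord i) (ltn_ord j) => /=.
    by case: (nat_of_ord i) => [|[|m]]; case: (nat_of_ord j) => [|[|n]]; lia.
  rewrite -eij in nu'v'.
  exact: reversals_incompatible (Lext i) uv' u'v nuv nu'v'.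
(* with the chain [c0 < c1 < c2 < c3], the reversals are in turn [a1 < a0],
   [a0 < c0], [a2 < a0], [c3 < a2], [a2 < a1], [a1 < c1] and [c2 < a1] *)
have [i1 n1] := rev (a 0 isT) (a 1 isT) isT.
have [i2 n2] := rev (c 0 isT) (a 0 isT) isT.
have [i3 n3] := rev (a 0 isT) (a 2 isT) isT.
have [i4 n4] := rev (a 2 isT) (c 3 isT) isT.
have [i5 n5] := rev (a 1 isT) (a 2 isT) isT.
have [i6 n6] := rev (c 1 isT) (a 1 isT) isT.
have [i7 n7] := rev (a 1 isT) (c 2 isT) isT.
have := incompatible _ _ _ _ _ _ n7 n1 isT isT.
have := incompatible _ _ _ _ _ _ n6 n7 isT isT.
have := incompatible _ _ _ _ _ _ n5 n6 isT isT.
have := incompatible _ _ _ _ _ _ n4 n5 isT isT.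
have := incompatible _ _ _ _ _ _ n3 n4 isT isT.
have := incompatible _ _ _ _ _ _ n2 n3 isT isT.
have := incompatible _ _ _ _ _ _ n1 n2 isT isT.
(* an odd cycle has no proper colouring with two colours *)
by do 7! case: (_ == 0).
Qed.

Theorem corollary1 :
  (forall (T : finType) (e : rel T),
     simple_graph e -> split_comparability_graph e ->
     forall le : rel T, induced_poset e le ->
     exists2 d : nat, has_dimension le d & d <= 3)
  /\
  (exists (T : finType) (e : rel T),
     [/\ simple_graph e, split_comparability_graph e &
         exists2 le : rel T, induced_poset e le & has_dimension le 3]).
Proof.
split=> [T e _ [eS _] le leP|].
  exact: realizable_has_dimension (split_realizable3 eS leP).
exists ('I_4 + 'I_3)%type, seven_graph; split.
- exact: seven_simple.
- exact: seven_split_comparability.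
- exists seven_le; first exact: seven_induced.
  split; last exact: seven_dim_ge3.
  exact: split_realizable3 seven_split seven_induced.
Qed.
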